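(* Let $n\ge 2$ be an integer, let $P_n$ be the path on $n$ vertices, and let $T(P_n)$ be its total graph. Then for every positive integer $t$, $T(P_n)$ has the $2t$-pebbling property.
   Context: The total graph $T(G)$ of a graph $G$ has vertex set $V(G)\cup E(G)$ (disjoint union). Two vertices of $T(G)$ are adjacent if the corresponding elements of $G$ are two adjacent vertices, two adjacent edges (edges sharing an endpoint), or a vertex and an edge incident to it. Explicitly, $T(P_n)$ has vertices $x_1,\dots,x_n$ and $y_{i(i+1)}$ ($1\le i\le n-1$), with edges $x_ix_{i+1}$, $x_iy_{i(i+1)}$, $x_{i+1}y_{i(i+1)}$ ($1\le i\le n-1$) and $y_{j(j+1)}y_{(j+1)(j+2)}$ ($1\le j\le n-2$). A configuration of pebbles on a connected graph $G$ assigns a nonnegative integer number of pebbles to each vertex; its size is the total number of pebbles. A pebbling move removes two pebbles from one vertex and places one pebble on a neighbouring vertex. For a positive integer $t$, the $t$-pebbling number $\pi_t(G)$ is the least positive integer such that from every configuration of $\pi_t(G)$ pebbles on $G$ and for every target vertex $v$, one can, by a (possibly empty) sequence of pebbling moves, reach a configuration with at least $t$ pebbles on $v$. For a configuration on $G$, let $q$ denote the number of vertices with at least one pebble. The graph $G$ has the $2t$-pebbling property if, for every configuration with $q$ occupied vertices and at least $2\pi_t(G)-q+1$ pebbles, and for every target vertex $v$, one can reach by pebbling moves a configuration with at least $2t$ pebbles on $v$. *)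

(* Defs.v *)
From Stdlib Require Import Relation_Operators.
From mathcomp Require Import all_boot.

Set Implicit Arguments.
Unset Strict Implicit.
Unset Printing Implicit Defensive.

Record sgraph := SGraph {
  vertex :> finType;
  adj : rel vertex;
  adj_sym : symmetric adj;
  adj_irrefl : irreflexive adj
}.

Definition edges (G : sgraph) : {set {set G}} :=
  [set [set p.1; p.2] | p : G * G & adj p.1 p.2].

Definition edge (G : sgraph) : finType := {E : {set G} | E \in edges G}.

Section PathGraph.
Variable n : nat.

Definition path_adj : rel 'I_n :=
  fun i j => (i.+1 == j :> nat) || (j.+1 == i :> nat).

Lemma path_adj_sym : symmetric path_adj.
Proof. by move=> i j; rewrite /path_adj orbC. Qed.

Lemma path_adj_irrefl : irreflexive path_adj.
Proof. by move=> i; rewrite /path_adj orbb gtn_eqF. Qed.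

Definition path_graph : sgraph := SGraph path_adj_sym path_adj_irrefl.
End PathGraph.

Section TotalGraph.
Variable G : sgraph.

Definition total_adj : rel (G + edge G)%type := fun a b =>
  match a, b with
  | inl x, inl y => adj x y
  | inl x, inr f => x \in val f
  | inr f, inl x => x \in val f
  | inr f, inr g => (f != g) && (val f :&: val g != set0)
  end.

Lemma total_adj_sym : symmetric total_adj.
Proof. by move=> [x|f] [y|g] //=; rewrite ?[adj x y]adj_sym // eq_sym setIC. Qed.

Lemma total_adj_irrefl : irreflexive total_adj.
Proof. by move=> [x|f] /=; rewrite ?adj_irrefl ?eqxx. Qed.

Definition total_graph : sgraph := SGraph total_adj_sym total_adj_irrefl.
End TotalGraph.

Section Pebbling.
Variable G : sgraph.

Definition config := {ffun G -> nat}.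

Definition config_size (c : config) : nat := \sum_(x : G) c x.

Definition occupied (c : config) : nat := #|[set x : G | 0 < c x]|.

Definition pebbling_move (c c' : config) : Prop :=
  exists u v : G, [/\ adj u v, 2 <= c u &
    c' = [ffun w => if w == u then c u - 2
                    else if w == v then c v + 1 else c w]].

Definition reachable : config -> config -> Prop :=
  clos_refl_trans config pebbling_move.

Definition can_reach (c : config) (v : G) (k : nat) : Prop :=
  exists c' : config, reachable c c' /\ k <= c' v.

Definition pebbling_suffices (t p : nat) : Prop :=
  forall (c : config) (v : G), config_size c = p -> can_reach c v t.

Definition is_pebbling_number (t p : nat) : Prop :=
  [/\ 0 < p, pebbling_suffices t p &
      forall m : nat, 0 < m -> pebbling_suffices t m -> p <= m].

(* The number p is unique when it exists. The bound
   config_size c >= 2 * p - occupied c + 1 is written additively because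
   subtraction on nat truncates. *)
Definition two_t_pebbling_property (t : nat) : Prop :=
  exists p : nat, is_pebbling_number t p /\
    forall (c : config) (v : G),
      2 * p + 1 <= config_size c + occupied c -> can_reach c v (2 * t).
End Pebbling.

(* Main.v *)
Require Import Defs.
From Stdlib Require Import Relation_Operators Classical.
From mathcomp Require Import all_boot zify.

(* The total graph of the path on d + 1 vertices is the square of the path
   0, ..., 2d: the vertices go to even and the edges to odd positions.  Its
   t-pebbling number is 2^d t + 1.

   Seen from a target, each side of the square consists of layers
   {2i - 1, 2i} at distance i.  Moving pebbles along the even positions only
   loses the odd pebble of each odd position, and such a lost pebble can be
   rescued at the price of one other pebble.  Induction on the number D of
   layers, pushing down the farthest layer, shows that s >= 1 pebbles reach
   the target if the side has more than 2^D s pebbles, and that s >= 2 reach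
   it if pebbles plus occupied vertices exceed 2^D s + 2; both bounds improve
   when the last layer has a single vertex.  In the induction step only
   configurations with almost no pebble below the farthest layer are not
   immediate.  If s pebbles cannot be brought to the target from its two
   sides, then one side fails to provide s1 and the other s2 pebbles with
   s1 + s2 = s + 1, and adding up the two bounds concludes. *)

Set Implicit Arguments.
Unset Strict Implicit.
Unset Printing Implicit Defensive.

(** * Moving pebbles towards 0 on one side of the target *)

Ltac update_lia := simpl; repeat match goal with
  | |- context [@eq_op _ ?x ?y] => case: (x =P y) => ?; try subst x
  | |- context [if leq ?x ?y then _ else _] => case: (leqP x y) => ?
  end; try lia.

(* All moves go towards 0, so that a configuration supported on 0, ..., L stays
   there and L need not be a parameter. *)
Inductive feeds (s : nat) : (nat -> nat) -> Prop :=
| feeds_done f : s <= f 0 -> feeds s f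
| feeds_move f u v : v < u <= v.+2 -> 1 < f u ->
    feeds s (fun w => if w == u then f u - 2
                      else if w == v then f v + 1 else f w) ->
    feeds s f.

Lemma feeds_le s f g : (forall i, f i <= g i) -> feeds s f -> feeds s g.
Proof.
move=> le_fg Hf; elim: Hf g le_fg => {f} [f sf|f u v uv fu _ IH] g le_fg.
  by apply: feeds_done; apply: leq_trans (le_fg 0).
apply: (feeds_move uv); first exact: leq_trans (le_fg u).
apply: IH => w /=; have := le_fg w; have := le_fg u; have := le_fg v.
by case: (w =P u) => _; last case: (w =P v) => _; lia.
Qed.

(** Induction on [k] batches equal moves. Bounding [g] only from above lets callers discard pebbles
    and keep a simple description of the result. *)
Lemma feeds_moves s k u v f g : v < u <= v.+2 -> 2 * k <= f u ->
  (forall w, g w <= if w == u then f u - 2 * k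
                    else if w == v then f v + k else f w) ->
  feeds s g -> feeds s f.
Proof.
move=> uv; elim: k f => [|k IH] f ku le_gf Hg.
  apply: feeds_le Hg => w; have := le_gf w.
  by case: eqP => [->|_]; last case: eqP => [->|_]; lia.
apply: (feeds_move uv); first by lia.
apply: IH Hg; first by rewrite eqxx; lia.
move=> w /=; have := le_gf w; rewrite !eqxx.
have -> : (v == u) = false by lia.
by case: (w =P u) => // _; last case: (w =P v) => // _; lia.
Qed.

(* The two vertices [2 i + 1] and [2 i + 2] of layer [i] are at distance
   [i + 1] from 0.  A pebble of layer [i] weighs [2 ^ (D - 1 - i)], and the odd
   pebble of each odd vertex, lost when all pebbles travel along the even
   vertices, weighs nothing. *)
Fixpoint weight (f : nat -> nat) (D : nat) : nat :=
  if D is E.+1 then 2 * weight f E + f E.*2.+2 + (f E.*2.+1)./2.*2 else f 0.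

Lemma weightS f D :
  weight f D.+1 = 2 * weight f D + f D.*2.+2 + (f D.*2.+1)./2.*2.
Proof. by []. Qed.

Lemma weight_eq f g D : (forall i, i <= D.*2 -> f i = g i) ->
  weight f D = weight g D.
Proof.
elim: D => [|D IH] fg /=; first exact: fg.
rewrite !fg ?doubleS // IH // => i iD; apply: fg; lia.
Qed.

Lemma weight_ge_top f D : f D.*2 <= weight f D.
Proof. by case: D => //= D; rewrite doubleS; lia. Qed.

Lemma weight_top f g D k : (forall i, i < D.*2 -> f i = g i) ->
  g D.*2 = f D.*2 + k -> weight g D = weight f D + k.
Proof.
case: D => [|D] fg gD //=; rewrite doubleS in gD.
rewrite gD -fg ?doubleS // (@weight_eq g f); first lia.
by move=> i iD; rewrite fg //; lia.
Qed.

Lemma feeds_weight f D s : 2 ^ D * s <= weight f D -> feeds s f.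
Proof.
elim: D f => [|D IH] f /= sW; first by apply: feeds_done; lia.
set a := f D.*2.+1 in sW; set b := f D.*2.+2 in sW.
set g := fun w => if w == D.*2 then f w + b./2 + a./2
                  else if w < D.*2 then f w else 0.
have Wg : weight g D = weight f D + (b./2 + a./2).
  by apply: weight_top; rewrite /g ?eqxx ?addnA // => i iD; rewrite iD ltn_eqF.
(* An odd pebble of [b] is lost here at no cost, since all the other terms of the inequality [sW]
   are even. *)
have Hg : feeds s g by apply: IH; rewrite Wg; rewrite expnS in sW; lia.
pose h (w : nat) := if w == D.*2 then f w + b./2
                    else if w <= D.*2.+1 then f w else 0.
apply: (@feeds_moves s b./2 D.*2.+2 D.*2 f h); first by lia.
- by rewrite -/b; lia.
- by move=> w; rewrite /h; update_lia.
apply: (@feeds_moves s a./2 D.*2.+1 D.*2 h g) => //; first by lia.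
- by rewrite /h -/a; update_lia.
- by move=> w; rewrite /h /g; update_lia.
Qed.

(** Each step down the odd vertices halves the group of [2 ^ (E - j)] pebbles, so exactly one of
    them arrives at [2 j + 1]. *)
Lemma feeds_cascade s f g E j : j <= E -> 2 ^ (E - j) <= f E.*2.+1 ->
  (forall w, g w <= f w - (w == E.*2.+1) * 2 ^ (E - j) + (w == j.*2.+1)) ->
  feeds s g -> feeds s f.
Proof.
elim: E f => [|E IH] f jE.
  have -> : j = 0 by lia.
  by move=> /= fE gf; apply: feeds_le => w; have := gf w; update_lia.
case: (ltngtP j E.+1) jE => // [jE _|-> _]; last first.
  rewrite subnn => /= fE gf; apply: feeds_le => w; have := gf w.
  by update_lia.
rewrite subSn // expnS => fE gf Hg; set p := 2 ^ (E - j) in fE gf.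
have p0 : 0 < p by rewrite expn_gt0.
apply: (@feeds_moves s p E.+1.*2.+1 E.*2.+1 f
         (fun w => if w == E.+1.*2.+1 then f w - 2 * p
                   else if w == E.*2.+1 then f w + p else f w)) => //.
- lia.
- by move=> w; update_lia.
apply: (IH) Hg; rewrite -/p //.
- by update_lia.
- by move=> w; have := gf w; update_lia.
Qed.

(** The new pebble completes a pair with the odd one that weighed nothing, and each of the two then
    weighs [2 ^ (D - 1 - j)]. *)
Lemma weight_bump f g D j : j < D -> odd (f j.*2.+1) ->
  (forall i, i <= D.*2 -> g i = f i + (i == j.*2.+1)) ->
  weight g D = weight f D + 2 ^ (D - j).
Proof.
move=> + oddf; elim: D => // D IH jD gf /=.
rewrite !gf ?doubleS //; have [jD'|jD'|eD] := ltngtP j D; last 2 first.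
- lia.
- subst D; rewrite subSnn (@weight_eq g f); first lia.
  by move=> i iD; rewrite gf; lia.
rewrite IH //; last by move=> i iD; apply: gf; lia.
by rewrite subSn 1?ltnW // expnS; lia.
Qed.

(* The lost pebble on [2 j + 1] is rescued by sending one pebble to it down
   the odd vertices; if the vertex [2 E + 1] at the top does not hold enough
   pebbles for this, it is first completed from its neighbour [2 E + 2]. *)
Lemma feeds_rescue f E j s : j < E -> odd (f j.*2.+1) -> 0 < f E.*2.+1 ->
  2 ^ E.+1 <= f E.*2.+2 + 2 * f E.*2.+1 ->
  2 ^ E.+1 * s <= weight f E.+1 + 2 -> feeds s f.
Proof.
move=> jE oddj a0 enough sW; set k := E - j.
set a := f E.*2.+1 in a0 enough; set b := f E.*2.+2 in enough.
set r := 2 ^ k - a.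
have lekE : 2 ^ k <= 2 ^ E by rewrite leq_exp2l // leq_subr.
rewrite expnS in enough.
have [q [kq q0]] : exists q, 2 ^ k = q.*2 /\ 0 < q.
  exists (2 ^ k.-1); rewrite expn_gt0; split=> //.
  by rewrite -mul2n -expnS prednK // subn_gt0.
pose h (w : nat) := if w == E.*2.+2 then b - 2 * r
            else if w == E.*2.+1 then a + r else f w.
apply: (@feeds_moves s r E.*2.+2 E.*2.+1 f h) => //; try by rewrite -/b; lia.
pose g (w : nat) := h w - (w == E.*2.+1) * 2 ^ k + (w == j.*2.+1).
apply: (@feeds_cascade s h g E j) => //; first by rewrite ltnW.
  by rewrite -/k /h; update_lia.
(* The rescue raises the weight by at least 2: by [2 ^ k] if [r = 0], and by [2 a - (a./2).*2]
   otherwise, where [a > 0]. *)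
apply: (@feeds_weight g E.+1); apply: leq_trans sW _ => /=.
have -> : weight g E = weight f E + 2 ^ k.
  apply: weight_bump => // i iE; rewrite /g /h.
  by update_lia.
have -> : g E.*2.+2 = b - 2 * r by rewrite /g /h; update_lia.
have -> : g E.*2.+1 = a + r - 2 ^ k by rewrite /g /h; update_lia.
rewrite -/a -/b; lia.
Qed.

(** * How many pebbles on one side suffice *)

Lemma sum_layerS (h : nat -> nat) D :
  \sum_(1 <= i < D.+1.*2.+1) h i
  = \sum_(1 <= i < D.*2.+1) h i + h D.*2.+1 + h D.*2.+2.
Proof. by rewrite doubleS big_nat_recr //= big_nat_recr. Qed.

(** Summed over the vertices, this is the size plus the number of occupied vertices. *)
Definition load (n : nat) : nat := n + (0 < n).

Definition singles (f : nat -> nat) (D : nat) : nat :=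
  \sum_(i < D) (f i.*2.+1 == 1).

Lemma singles_gt0 f D : 0 < singles f D -> exists2 j, j < D & f j.*2.+1 = 1.
Proof.
rewrite /singles; elim: D => [|D IH]; first by rewrite big_ord0.
rewrite big_ord_recr /=; case: eqP => [fD _|_]; first by exists D.
by rewrite addn0 => /IH[j jD fj]; exists j => //; lia.
Qed.

(** [load n] exceeds [2 * (n./2).*2] only for [n = 1], so only odd positions with a single pebble
    need a correction, of 2 each. *)
Lemma load_le_weight f D :
  \sum_(1 <= i < D.*2.+1) load (f i) <= 2 * weight f D + 2 * singles f D.
Proof.
elim: D => [|D IH]; first by rewrite big_geq.
rewrite sum_layerS /singles big_ord_recr /= -/(singles f D).
by move: IH; rewrite /load; case: eqP => /=; lia.
Qed.

Lemma load_ge_singles f D :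
  2 * singles f D <= \sum_(1 <= i < D.*2.+1) load (f i).
Proof.
rewrite /singles; elim: D => [|D IH]; first by rewrite big_ord0.
rewrite sum_layerS big_ord_recr /=.
by move: IH; rewrite /load; case: eqP => /=; lia.
Qed.

Definition shift_layer (f : nat -> nat) (E x y w : nat) : nat :=
  if w == E.*2.+2 then f w + y
  else if w == E.*2.+1 then f w + x
  else if w <= E.*2 then f w else 0.

(** In the layer below, [2 E + 3] is adjacent to both vertices but [2 E + 4] only to [2 E + 2].
    Hence only the pairs on [2 E + 3] can be distributed freely, as [x] and [y]. *)
Lemma feeds_shift f E x y s : x + y <= (f E.*2.+3)./2 ->
  feeds s (shift_layer f E x (y + (f E.*2.+4)./2)) -> feeds s f.
Proof.
move=> xy Hs; set a := f E.*2.+3 in xy; set b := f E.*2.+4 in Hs.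
pose h1 (w : nat) := if w == E.*2.+4 then 0
  else if w == E.*2.+2 then f w + b./2 else f w.
pose h2 (w : nat) := if w == E.*2.+3 then a - 2 * x
  else if w == E.*2.+1 then h1 w + x else h1 w.
apply: (@feeds_moves s b./2 E.*2.+4 E.*2.+2 f h1); first by lia.
- by rewrite -/b; lia.
- by move=> w; rewrite /h1 -/b; update_lia.
apply: (@feeds_moves s x E.*2.+3 E.*2.+1 h1 h2); first by lia.
- by rewrite /h1 -/a; update_lia.
- by move=> w; rewrite /h2 /h1 -/a -/b; update_lia.
apply: (@feeds_moves s y E.*2.+3 E.*2.+2 h2 _) Hs; first by lia.
- by rewrite /h2; update_lia.
- by move=> w; rewrite /h2 /h1 /shift_layer -/a -/b; update_lia.
Qed.

Lemma sum_shift_layer (h : nat -> nat) f E x y :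
  \sum_(1 <= i < E.+1.*2.+1) h (shift_layer f E x y i)
  = \sum_(1 <= i < E.*2.+1) h (f i) + h (f E.*2.+1 + x) + h (f E.*2.+2 + y).
Proof.
rewrite sum_layerS; congr (_ + _ + _); last first.
- by congr h; rewrite /shift_layer; update_lia.
- by congr h; rewrite /shift_layer; update_lia.
by apply: eq_big_nat => i iE; congr h; rewrite /shift_layer; update_lia.
Qed.

Lemma feeds_size f D s : 0 < D -> 0 < s ->
  2 ^ D * s < \sum_(1 <= i < D.*2.+1) f i + (f D.*2 == 0) -> feeds s f.
Proof.
move=> + s0; case: D => // E _; elim: E f => [|E IH] f.
  rewrite sum_layerS big_geq // expn1 -[1.*2]/2 -[0.*2.+1]/1 -[0.*2.+2]/2.
  move=> sf; apply: (@feeds_weight f 1); rewrite /= -[0.*2.+1]/1 -[0.*2.+2]/2.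
  by move: sf; case: eqP; lia.
have X2 : 2 <= 2 ^ E.+1 by rewrite -{1}[2]expn1 leq_exp2l.
have PX : 2 ^ E.+1 <= 2 ^ E.+1 * s by rewrite leq_pmulr.
rewrite [2 ^ E.+2]expnS -mulnA.
set P := 2 ^ E.+1 * s in IH PX *.
have IHs x y : x + y <= (f E.*2.+3)./2 ->
    P < \sum_(1 <= i < E.*2.+1) f i + (f E.*2.+1 + x)
         + (f E.*2.+2 + (y + (f E.*2.+4)./2))
         + (f E.*2.+2 + (y + (f E.*2.+4)./2) == 0) -> feeds s f.
  move=> xy HP; apply: (feeds_shift xy); apply: IH.
  by rewrite (sum_shift_layer id) /shift_layer doubleS eqxx.
have Wfeeds : 2 * P <= 2 * weight f E.+1 + f E.*2.+4 + (f E.*2.+3)./2.*2 ->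
    feeds s f.
  move=> PW; apply: (@feeds_weight f E.+2).
  by rewrite weightS doubleS [2 ^ _]expnS -mulnA.
have lowW := load_le_weight f E.+1.
have bW := weight_ge_top f E.+1.
have lowS : \sum_(1 <= i < E.+1.*2.+1) f i
            <= \sum_(1 <= i < E.+1.*2.+1) load (f i).
  by apply: leq_sum => i _; rewrite leq_addr.
have lone := @singles_gt0 f E.+1.
rewrite 2!sum_layerS in lowS;
  rewrite sum_layerS in lowW; rewrite 2!sum_layerS.
set low := \sum_(1 <= i < E.*2.+1) f i in IHs lowS *.
rewrite !doubleS in bW lone *.
set a1 := f E.*2.+1 in IHs lowS lowW *.
set b1 := f E.*2.+2 in IHs lowS lowW bW *.
set a := f E.*2.+3 in IHs Wfeeds *; set b := f E.*2.+4 in IHs Wfeeds *.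
move=> PQ.
(* Pebbles below the top layer are not halved, so two of them pay for the odd pebbles lost from [a]
   and [b]. *)
case: (leqP 2 (low + a1 + b1)) => low2.
  by apply: (IHs 0 a./2); lia.
case: (posnP (singles f E.+1)) => [m0|/lone[j jE fj]].
  case: (posnP b1) => [b10|b10]; last by apply: Wfeeds; lia.
  case: (posnP b) => [b0|b0]; last by apply: Wfeeds; lia.
  by apply: (IHs a./2 0); lia.
case: (posnP b) => [b0|b0].
  case: (posnP b1) => [b10|b10]; last by apply: Wfeeds; lia.
  by apply: (IHs a./2 0); lia.
(* Pushing down now loses two pebbles only if [a] and [b] are both odd; then the lone pebble at
   [2 j + 1] is rescued. *)
case: (boolP (odd a && odd b)) => [/andP[oa ob]|oab]; last first.
  case: (posnP (low + a1 + b1)) => [n0|n0]; first by apply: Wfeeds; lia.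
  by apply: (IHs 0 a./2); lia.
apply: (@feeds_rescue f E.+1 j) => //; rewrite ?fj ?doubleS // -/a -/b.
- lia.
- by rewrite expnS; lia.
- by rewrite expnS -mulnA -/P weightS !doubleS -/a -/b; lia.
Qed.

Lemma feeds_load f D s : 0 < D -> 1 < s ->
  2 ^ D * s + 2 * (0 < f D.*2) < \sum_(1 <= i < D.*2.+1) load (f i) ->
  feeds s f.
Proof.
move=> + s1; case: D => // E _; elim: E f => [|E IH] f.
  rewrite sum_layerS big_geq // expn1 -[1.*2]/2 -[0.*2.+1]/1 -[0.*2.+2]/2.
  move=> sf; apply: (@feeds_weight f 1); rewrite /= -[0.*2.+1]/1 -[0.*2.+2]/2.
  by move: sf; rewrite /load; lia.
have X2 : 2 <= 2 ^ E.+1 by rewrite -{1}[2]expn1 leq_exp2l.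
have PX : 2 * 2 ^ E.+1 <= 2 ^ E.+1 * s by rewrite mulnC leq_pmul2l ?expn_gt0.
rewrite [2 ^ E.+2]expnS -mulnA.
set P := 2 ^ E.+1 * s in IH PX *.
have IHs x y : x + y <= (f E.*2.+3)./2 ->
    P + 2 * (0 < f E.*2.+2 + (y + (f E.*2.+4)./2))
      < \sum_(1 <= i < E.*2.+1) load (f i) + load (f E.*2.+1 + x)
         + load (f E.*2.+2 + (y + (f E.*2.+4)./2)) -> feeds s f.
  move=> xy HP; apply: (feeds_shift xy); apply: IH.
  by rewrite (sum_shift_layer load) /shift_layer doubleS eqxx.
have Wfeeds : 2 * P <= 2 * weight f E.+1 + f E.*2.+4 + (f E.*2.+3)./2.*2 ->
    feeds s f.
  move=> PW; apply: (@feeds_weight f E.+2).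
  by rewrite weightS doubleS [2 ^ _]expnS -mulnA.
have lowW := load_le_weight f E.+1.
have lowm := load_ge_singles f E.
have lone := @singles_gt0 f E.+1.
have mE : singles f E.+1 = singles f E + (f E.*2.+1 == 1).
  by rewrite /singles big_ord_recr.
rewrite sum_layerS in lowW; rewrite 2!sum_layerS.
rewrite !doubleS in lone *.
set low := \sum_(1 <= i < E.*2.+1) load (f i) in IHs lowW lowm *.
have bW := weight_ge_top f E.+1; rewrite doubleS in bW.
set m := singles f E in lowm mE; set M := singles f E.+1 in mE lowW lone.
set a1 := f E.*2.+1 in IHs mE lowW *.
set b1 := f E.*2.+2 in IHs bW lowW *.
set a := f E.*2.+3 in IHs Wfeeds *; set b := f E.*2.+4 in IHs Wfeeds *.
rewrite /load in IHs lowW *.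
move=> PQ.
case: (posnP M) => [M0|M0].
  by apply: Wfeeds; case: (posnP b) PQ => ?; lia.
have Ma1 : 2 * M <= low + (a1 + (0 < a1)) by move: mE; case: eqP; lia.
case: (posnP a) => [a0|a0].
  case: (posnP b) => [b0|b0].
    case: (posnP b1) => [b10|b10]; first by apply: (IHs a./2 0); lia.
    by apply: (IHs a./2 0); lia.
  case: (leqP M 1) => M1; first by apply: Wfeeds; lia.
  by apply: (IHs a./2 0); lia.
(* The load below counts twice against the doubled bound of the induction hypothesis; 6 covers its
   correction term and the odd pebbles lost. *)
case: (leqP 6 (low + (a1 + (0 < a1)) + (b1 + (0 < b1)))) => low6.
  by apply: (IHs 0 a./2); lia.
(* Sending all pairs of [a] to [2 E + 1] keeps [2 E + 2] empty, so the induction hypothesis applies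
   without its correction term. *)
have [small|] := boolP [&& b == 0 & b1 == 0].
  by apply: (IHs a./2 0); lia.
rewrite negb_and => new.
have [M1|M2] := leqP M 1; last by apply: (IHs 0 a./2); lia.
have [j jE fj] := lone M0.
have [spread|tight] := boolP ((b1 == 0) && (4 <= low + (a1 + (0 < a1)))).
  by apply: (IHs 0 a./2); lia.
(* As [M = 1], the weight falls short of the bound by at most 2, which is what a rescue gains. *)
apply: (@feeds_rescue f E.+1 j) => //; rewrite ?fj ?doubleS // -/a -/b.
- by rewrite expnS; lia.
- by rewrite expnS -mulnA -/P weightS !doubleS -/a -/b; lia.
Qed.

(** * From one side to configurations on a graph *)

(** The offset [z] stands for pebbles on the target that do not come from this side. As nothing
    changes off the image of [r], the two sides can be used one after the other. *)
Lemma feeds_reachable (G : sgraph) (r : nat -> G) L s f :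
  (forall i j, i <= L -> j <= L -> r i = r j -> i = j) ->
  (forall i j, j < i <= j.+2 -> i <= L -> adj (r i) (r j)) ->
  feeds s f -> (forall i, L < i -> f i = 0) ->
  forall (c : config G) z, c (r 0) = f 0 + z ->
  (forall i, 0 < i <= L -> c (r i) = f i) ->
  exists c', [/\ reachable c c', s + z <= c' (r 0) &
    forall x, (forall i, i <= L -> x != r i) -> c' x = c x].
Proof.
move=> r_inj r_adj; elim=> {f} [f sf|f u v uv fu _ IH] f0 c z c0 cf.
  by exists c; split=> //; [exact: rt_refl | rewrite c0 leq_add2r].
have uL : u <= L by rewrite leqNgt; apply/negP => /f0; lia.
have vL : v <= L by lia.
have uE : 0 < u <= L by lia.
pose c1 : config G := [ffun w => if w == r u then c (r u) - 2
                       else if w == r v then c (r v) + 1 else c w].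
have r_eq i j : i <= L -> j <= L -> (r i == r j) = (i == j).
  by move=> iL jL; apply/eqP/eqP => [/r_inj|->] //; apply.
have [i iL|||c' [c1c' sc' c'c1]] := IH _ c1 z.
- by rewrite /= !gtn_eqF ?f0 //; lia.
- rewrite /= ffunE !r_eq //; case: eqP => [|_]; first by lia.
  by case: eqP => [<-|_] //; rewrite c0; lia.
- move=> i iL /=; have [_ iL1] := andP iL.
  rewrite ffunE !r_eq // (cf u uE) (cf i iL).
  by case: (i =P u) => // _; case: (i =P v) => // iv; rewrite -iv cf.
exists c'; split=> //.
- apply: rt_trans c1c'; apply: rt_step; exists (r u), (r v); split=> //.
    by apply: r_adj.
  by rewrite cf.
- move=> x xr; rewrite c'c1 // ffunE.
  by rewrite (negPf (xr u uL)) (negPf (xr v vL)).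
Qed.

(** The value at 0 is 0 because the target belongs to both sides; its pebbles are counted
    separately. *)
Definition side (G : sgraph) (c : config G) (r : nat -> G) (L i : nat) : nat :=
  if 0 < i <= L then c (r i) else 0.

Lemma sum_side (G : sgraph) (c : config G) (r : nat -> G) L (h : nat -> nat) :
  h 0 = 0 ->
  \sum_(1 <= i < (uphalf L).*2.+1) h (side c r L i)
  = \sum_(1 <= i < L.+1) h (c (r i)).
Proof.
move=> h0.
have -> : (uphalf L).*2.+1 = L.+1 + odd L by lia.
have -> : \sum_(1 <= i < L.+1) h (c (r i))
          = \sum_(1 <= i < L.+1) h (side c r L i).
  by apply: eq_big_nat => i iL; rewrite /side; case: ifP => //; lia.
case: (odd L); rewrite ?addn0 // addn1 big_nat_recr //=.
by rewrite /side ltnn /= h0 addn0.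
Qed.

(** Contrapositive of [feeds_size]. For odd [L] the last layer lacks its even vertex, which gives
    the extra 1. *)
Lemma side_size_le (G : sgraph) (c : config G) (r : nat -> G) L s :
  ~ feeds s (side c r L) ->
  \sum_(1 <= i < L.+1) c (r i) + odd L <= 2 ^ uphalf L * s.
Proof.
move=> nf; have [->|L0] := posnP L; first by rewrite big_geq.
rewrite leqNgt; apply/negP => sn; apply: nf.
case: s sn => [|s] sn; first exact: feeds_done.
apply: (@feeds_size _ (uphalf L)) => //; first by lia.
rewrite (sum_side _ _ _ (h := id)) //; apply: leq_trans sn _.
rewrite leq_add2l /side; case: ifP; lia.
Qed.

Lemma side_load_le (G : sgraph) (c : config G) (r : nat -> G) L s :
  1 < s -> ~ feeds s (side c r L) ->
  \sum_(1 <= i < L.+1) load (c (r i)) <= 2 ^ uphalf L * s + 2 * ~~ odd L.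
Proof.
move=> s1 nf; have [->|L0] := posnP L; first by rewrite big_geq.
rewrite leqNgt; apply/negP => sn; apply: nf.
apply: (@feeds_load _ (uphalf L)) => //; first by lia.
rewrite (sum_side _ _ _ (h := load)) //; apply: leq_ltn_trans sn.
rewrite leq_add2l /side; case: ifP; lia.
Qed.

(** * Combining the two sides of a target in the square of a path *)

Definition enumerates_path_square (G : sgraph) (N : nat) (e : nat -> G) : Prop :=
  [/\ forall i j, i <= N -> j <= N -> e i = e j -> i = j,
      forall x, exists2 i, i <= N & x = e i &
      forall i j, i <= N -> j <= N ->
        adj (e i) (e j) = [&& i != j, i <= j.+2 & j <= i.+2]].

Lemma sum_vertices (G : sgraph) N (e : nat -> G) (F : G -> nat) :
  enumerates_path_square N e -> \sum_x F x = \sum_(i < N.+1) F (e i).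
Proof.
move=> [e_inj e_surj _]; rewrite -(big_mkord xpredT (fun i => F (e i))).
rewrite -(big_map e xpredT F); apply: perm_big; apply: uniq_perm.
- exact: index_enum_uniq.
- rewrite map_inj_in_uniq ?iota_uniq // => i j.
  by rewrite !mem_index_iota !ltnS /= => iN jN; apply: e_inj.
- move=> x; rewrite mem_index_enum; apply/esym/mapP.
  by have [i iN ->] := e_surj x; exists i; rewrite // mem_index_iota ltnS.
Qed.

Lemma sum_sides (G : sgraph) N (e : nat -> G) (F : G -> nat) k :
  enumerates_path_square N e -> k <= N ->
  \sum_x F x = F (e k) + (\sum_(1 <= i < (N - k).+1) F (e (k + i))
                          + \sum_(1 <= i < k.+1) F (e (k - i))).
Proof.
move=> eP kN; rewrite (sum_vertices _ eP) -(big_mkord xpredT (fun i => F (e i))).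
rewrite (@big_cat_nat _ _ _ k) //=; last by lia.
rewrite (@big_ltn _ _ _ k) ?ltnS // addnC -addnA; congr (_ + (_ + _)).
  rewrite -[k.+1]add1n big_addn subSn //.
  by apply: eq_big_nat => i _; rewrite addnC.
rewrite -{1}[0]/(1 - 1) big_nat_rev big_add1 /= .
apply: eq_big_nat => i ik; congr (F (e _)); lia.
Qed.

(** Applied to [feeds], which comes without a decision procedure; hence the excluded middle. *)
Lemma max_below (P : nat -> Prop) t :
  P 0 -> P t \/ exists2 r, r < t & P r /\ ~ P r.+1.
Proof.
move=> P0; elim: t => [|t [IH|[r rt Pr]]]; first by left.
  by case: (classic (P t.+1)) => Pt; [left | right; exists t].
by right; exists r => //; apply: ltnW.
Qed.

Lemma feeds_sides (G : sgraph) N (e : nat -> G) (c : config G) k s1 s2 :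
  enumerates_path_square N e -> k <= N ->
  feeds s1 (side c (fun i => e (k + i)) (N - k)) ->
  feeds s2 (side c (fun i => e (k - i)) k) ->
  can_reach c (e k) (c (e k) + (s1 + s2)).
Proof.
move=> [e_inj _ e_adj] kN f1 f2.
have := @feeds_reachable G (fun i => e (k + i)) (N - k) s1 _ _ _ f1 _
          c (c (e k)).
case.
- by move=> i j iN jN /e_inj; lia.
- by move=> i j ij iN; rewrite e_adj; lia.
- by move=> i iN; rewrite /side; case: ifP; lia.
- by rewrite addn0.
- by move=> i iN; rewrite /side iN.
move=> c1 [cc1 sc1 c1c]; rewrite addn0 in sc1.
have := @feeds_reachable G (fun i => e (k - i)) k s2 _ _ _ f2 _ c1 (c1 (e k)).
case.
- by move=> i j iN jN /e_inj; lia.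
- by move=> i j ij iN; rewrite e_adj; lia.
- by move=> i iN; rewrite /side; case: ifP; lia.
- by rewrite subn0.
- move=> i ik; rewrite /side ik c1c // => j jN.
  by apply/eqP => /e_inj; lia.
move=> c2 [c1c2 sc2 _]; rewrite subn0 in sc2.
by exists c2; split; [exact: rt_trans cc1 c1c2 | lia].
Qed.

(** If the first side provides [r < s] pebbles but not [r + 1], the second must fail to provide
    [s - r]; take [s1 = r + 1] and [s2 = s - r]. *)
Lemma reach_or_split (G : sgraph) N (e : nat -> G) (c : config G) k s :
  enumerates_path_square N e -> k <= N ->
  can_reach c (e k) (c (e k) + s) \/ exists s1 s2,
    [/\ 0 < s1, 0 < s2, s1 + s2 = s.+1,
        ~ feeds s1 (side c (fun i => e (k + i)) (N - k)) &
        ~ feeds s2 (side c (fun i => e (k - i)) k)].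
Proof.
move=> eP kN.
have feeds0 f : feeds 0 f by apply: feeds_done.
have [f1|[r rs [f1 nf1]]] :=
    @max_below (feeds^~ (side c (fun i => e (k + i)) (N - k))) s (feeds0 _).
  by left; have := feeds_sides eP kN f1 (feeds0 _); rewrite addn0.
case: (classic (feeds (s - r) (side c (fun i => e (k - i)) k))) => f2.
  by left; have := feeds_sides eP kN f1 f2; rewrite subnKC // ltnW.
by right; exists r.+1, (s - r); split=> //; lia.
Qed.

(** * Inequalities for adding the bounds of the two sides *)

(** Here [x] and [y] stand for the powers of 2 of the two sides. Written in [x - 2], [y - 2],
    [s1 - 1] and [s2 - 1], the difference has nonnegative coefficients. *)
Lemma product_even x y s1 s2 : 1 < x -> 1 < y -> 0 < s1 -> 0 < s2 ->
  x * s1 + y * s2 + 2 * (s1 + s2) <= x * y * (s1 + s2).-1 + 4.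
Proof.
case: x y s1 s2 => [|[|x]] // [|[|y]] // [|u] // [|v] // _ _ _ _.
rewrite addSnnS addnS /=.
have := leq0n (x * y * u + x * y * v + x * y + x * u + x * v + y * u + y * v).
have -> : x.+2 * y.+2 * (u + v.+1)
  = (x.+2 * u.+1 + y.+2 * v.+1) + 2 * (u + v)
    + (x * y * u + x * y * v + x * y + x * u + 2 * (x * v)
       + x + 2 * (y * u) + y * v + y) by lia.
lia.
Qed.

Lemma product_odd x y z s1 s2 : 1 < x -> 1 < y -> 0 < s1 -> 0 < s2 ->
  x * y = 2 * z -> x * s1 + y * s2 <= z * (s1 + s2).-1 + 2.
Proof.
case: x y s1 s2 => [|[|x]] // [|[|y]] // [|u] // [|v] // _ _ _ _ xyz.
rewrite addSnnS addnS /=.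
have : x.+2 * y.+2 * (u + v.+1) + 4
  = 2 * (x.+2 * u.+1 + y.+2 * v.+1)
    + (x * y * u + x * y * v + x * y + 2 * (x * v) + 2 * (y * u)) by lia.
rewrite xyz -[2 * z * _]mulnA; lia.
Qed.

Lemma product_even_one x y s : 1 < x -> 1 < y -> 1 < s ->
  2 * x + y * s <= x * y * s.
Proof.
case: x y s => [|[|x]] // [|[|y]] // [|[|s]] // _ _ _.
have -> : x.+2 * y.+2 * s.+2 = 2 * x.+2 + y.+2 * s.+2
  + (x * y * s + 2 * (x * y) + 2 * (x * s) + 2 * x + y * s + 2 * y + 2 * s)
  by lia.
by rewrite leq_addr.
Qed.

Lemma product_odd_one x y z s : 1 < x -> 1 < y -> 1 < s -> x * y = 2 * z ->
  2 * x + y * s <= z * s + 4.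
Proof.
case: x y s => [|[|x]] // [|[|y]] // [|[|s]] // _ _ _ xyz.
have : x.+2 * y.+2 * s.+2 + 8 = 2 * (2 * x.+2 + y.+2 * s.+2)
  + (x * y * s + 2 * (x * y) + 2 * (x * s)) by lia.
rewrite xyz -[2 * z * _]mulnA; lia.
Qed.

(** Both sides together have [d] layers for even [k], and [d + 1] for odd [k], where both outermost
    layers are single vertices. *)
Lemma uphalf_split d k : k <= d.*2 ->
  2 ^ uphalf k * 2 ^ uphalf (d.*2 - k) = 2 ^ odd k * 2 ^ d.
Proof.
by move=> kd; rewrite -!expnD; congr (2 ^ _); lia.
Qed.

(** * Sufficient conditions for reaching a target *)

Lemma reach_of_size (G : sgraph) d (e : nat -> G) (c : config G) k s :
  enumerates_path_square d.*2 e -> k <= d.*2 ->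
  2 ^ d * s + c (e k) < config_size c -> can_reach c (e k) (c (e k) + s).
Proof.
move=> eP kN; rewrite /config_size (sum_sides _ eP kN) => big.
have [//|[s1 [s2 [s10 s20 es nf1 nf2]]]] := reach_or_split c s eP kN.
have := side_size_le nf1; have := side_size_le nf2; have xy := uphalf_split kN.
have n1_0 L : L = 0 -> \sum_(1 <= i < L.+1) c (e (k + i)) = 0.
  by move=> ->; rewrite big_geq.
have n2_0 L : L = 0 -> \sum_(1 <= i < L.+1) c (e (k - i)) = 0.
  by move=> ->; rewrite big_geq.
move: (n1_0 (d.*2 - k)) (n2_0 k) big.
set n1 := \sum_(1 <= i < _) c (e (k + i)).
set n2 := \sum_(1 <= i < _) c (e (k - i)) => {}n1_0 {}n2_0 big le_n2 le_n1.
exfalso; have [k0|k0] := posnP k.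
  move: le_n1 big; rewrite k0 subn0 n2_0 // uphalf_double.
  by have : 2 ^ d * s1 <= 2 ^ d * s; [rewrite leq_mul2l | ]; lia.
have [kd|kd] := posnP (d.*2 - k).
  have kE : uphalf k = d by lia.
  move: le_n2 big; rewrite n1_0 // kE.
  by have : 2 ^ d * s2 <= 2 ^ d * s; [rewrite leq_mul2l | ]; lia.
have x2 : 1 < 2 ^ uphalf k by rewrite (@ltn_exp2l 2 0) //; lia.
have y2 : 1 < 2 ^ uphalf (d.*2 - k) by rewrite (@ltn_exp2l 2 0) //; lia.
have oddE : odd (d.*2 - k) = odd k by lia.
rewrite oddE in le_n1; set x := 2 ^ uphalf k in x2 le_n2 xy.
set y := 2 ^ _ in y2 le_n1 xy.
(* For odd [k] the extra 1 from each side cancels the 2 in [product_odd]; for even [k],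
   [2 * (s1 + s2)] is at least the 4 in [product_even]. *)
case: (odd k) le_n1 le_n2 xy => le_n1 le_n2 xy.
  by have := product_odd y2 x2 s10 s20 (etrans (mulnC _ _) xy); rewrite es; lia.
have yx : y * x = 2 ^ d by rewrite mulnC xy mul1n.
by have := product_even y2 x2 s10 s20; rewrite es yx; lia.
Qed.

(** The load bound is missing for [s' = 1], but then the load is at most [2 * n], hence at most
    [2 * z], and [s] is at least 2. *)
Lemma load_one_side z s s' n q : 0 < s' <= s -> 1 < s ->
  n <= z * s' -> q <= 2 * n -> (1 < s' -> q <= z * s' + 2) -> q <= z * s + 2.
Proof.
move=> /andP[s'0 s's] s1 le_n nq le_q.
have [s'1|s'1] := leqP s' 1; last first.
  by apply: leq_trans (le_q s'1) _; rewrite leq_add2r leq_mul2l s's orbT.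
have s'E : s' = 1 by apply/eqP; rewrite eqn_leq s'1.
rewrite s'E muln1 in le_n.
have : z * 2 <= z * s by rewrite leq_mul2l s1 orbT.
clear -le_n nq; lia.
Qed.

(** At most one of [s1] and [s2] is 1. That side's load is bounded by twice its size, and the other
    side then has the full [s]. *)
Lemma load_two_sides (b : bool) x y z s s1 s2 n1 n2 q1 q2 :
  1 < x -> 1 < y -> 1 < s -> 0 < s1 -> 0 < s2 -> s1 + s2 = s.+1 ->
  x * y = 2 ^ b * z -> n1 + b <= x * s1 -> n2 + b <= y * s2 ->
  q1 <= 2 * n1 -> q2 <= 2 * n2 ->
  (1 < s1 -> q1 <= x * s1 + 2 * ~~ b) -> (1 < s2 -> q2 <= y * s2 + 2 * ~~ b) ->
  q1 + q2 <= z * s + 2.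
Proof.
have one_pebble x' y' s' n' q1' q2' : 1 < x' -> 1 < y' -> 1 < s' ->
    x' * y' = 2 ^ b * z -> n' + b <= x' -> q1' <= 2 * n' ->
    q2' <= y' * s' + 2 * ~~ b -> q1' + q2' <= z * s' + 2.
  move=> x1 y1 s1' xy le_n nq le_q; case: b le_n le_q xy => /= le_n le_q xy.
    have := product_odd_one x1 y1 s1' xy; clear -le_n nq le_q; lia.
  have := product_even_one x1 y1 s1'; rewrite xy mul1n.
  clear -le_n nq le_q; lia.
move=> x1 y1 s_1 s10 s20 es xy le_n1 le_n2 nq1 nq2 le_q1 le_q2.
have [s1_1|s1_gt1] := leqP s1 1.
  have s1E : s1 = 1 by apply/eqP; rewrite eqn_leq s1_1.
  have s2E : s2 = s by move: es; rewrite s1E => -[].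
  rewrite s2E in le_q2; rewrite s1E muln1 in le_n1.
  by apply: (one_pebble x y s n1) => //; apply: le_q2.
have [s2_1|s2_gt1] := leqP s2 1.
  have s2E : s2 = 1 by apply/eqP; rewrite eqn_leq s2_1.
  have s1E : s1 = s by move: es; rewrite s2E addn1 => -[].
  rewrite s1E in le_q1; rewrite s2E muln1 in le_n2; rewrite addnC.
  by apply: (one_pebble y x s n2) => //; [rewrite mulnC | apply: le_q1].
move: (le_q1 s1_gt1) (le_q2 s2_gt1) => {}le_q1 {}le_q2.
case: b xy le_q1 le_q2 {one_pebble le_n1 le_n2} => /= xy le_q1 le_q2.
  have := product_odd x1 y1 s10 s20 xy; rewrite es.
  clear -le_q1 le_q2; lia.
have := product_even x1 y1 s10 s20; rewrite es xy mul1n.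
clear -le_q1 le_q2 s1_gt1 s2_gt1 es; lia.
Qed.

Lemma reach_of_load (G : sgraph) d (e : nat -> G) (c : config G) k s :
  enumerates_path_square d.*2 e -> k <= d.*2 -> 1 < s ->
  2 ^ d * s + 2 + load (c (e k)) < \sum_x load (c x) ->
  can_reach c (e k) (c (e k) + s).
Proof.
move=> eP kN s_gt1; rewrite (sum_sides _ eP kN).
have [//|[s1 [s2 [s10 s20 es nf1 nf2]]]] := reach_or_split c s eP kN.
have le_n1 := side_size_le nf1; have le_n2 := side_size_le nf2.
have le_q1 s1_gt1 := side_load_le s1_gt1 nf1.
have le_q2 s2_gt1 := side_load_le s2_gt1 nf2.
have load2 L (r : nat -> G) : \sum_(1 <= i < L.+1) load (c (r i))
                              <= 2 * \sum_(1 <= i < L.+1) c (r i).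
  by rewrite big_distrr; apply: leq_sum => i _; rewrite /load /= mul2n -addnn
    leq_add2l; case: (c _).
have sum0 L (r : nat -> G) : L = 0 -> \sum_(1 <= i < L.+1) load (c (r i)) = 0.
  by move=> ->; rewrite big_geq.
have [les1 les2] : s1 <= s /\ s2 <= s by clear -s10 s20 es; lia.
rewrite [_ * s + 2 + _]addnC ltn_add2l ltnNge => /negP big; exfalso; apply: big.
have [k0|k0] := posnP k.
  have kE : uphalf (d.*2 - k) = d by clear -k0; lia.
  rewrite [X in _ + X](sum0 _ (fun i => e (k - i)) k0) addn0.
  rewrite kE in le_n1 le_q1.
  apply: (@load_one_side _ s s1 _ _ _ s_gt1 (leq_trans (leq_addr _ _) le_n1)) => //.
    by rewrite s10.
  by move=> /le_q1/leq_trans; apply; rewrite leq_add2l; case: odd.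
have [kd|kd] := posnP (d.*2 - k).
  have kE : uphalf k = d by clear -kd kN; lia.
  rewrite [X in X + _](sum0 _ (fun i => e (k + i)) kd) add0n.
  rewrite kE in le_n2 le_q2.
  apply: (@load_one_side _ s s2 _ _ _ s_gt1 (leq_trans (leq_addr _ _) le_n2)) => //.
    by rewrite s20.
  by move=> /le_q2/leq_trans; apply; rewrite leq_add2l; case: odd.
have xy := uphalf_split kN; rewrite mulnC in xy.
have oddE : odd (d.*2 - k) = odd k by clear -kN; lia.
rewrite oddE in le_n1 le_q1.
apply: load_two_sides xy le_n1 le_n2 _ _ le_q1 le_q2 => //.
- by rewrite (@ltn_exp2l 2 0) //; clear -kd; lia.
- by rewrite (@ltn_exp2l 2 0) //; clear -k0; lia.
Qed.

(** * Lower bound on the pebbling number by a potential *)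

(* Pebbles on the two vertices at maximal distance [d.+1] from the vertex 0
   only count in pairs: this is what makes [2 ^ d.+1 * t + 1] optimal. *)
Definition height (d i n : nat) : nat :=
  if i <= d.*2 then n * 2 ^ (d - uphalf i) else n./2.

(** A move changes the distance to 0 by at most one, so the new pebble is worth at most the two
    removed; an outermost pair is worth 1, as is a pebble in the layer below. *)
Lemma height_move d i j n m : i <= d.+1.*2 -> j <= d.+1.*2 ->
  i <= j.+2 -> j <= i.+2 -> 1 < n ->
  height d i (n - 2) + height d j (m + 1) <= height d i n + height d j m.
Proof.
move=> iN jN ij ji n2; rewrite /height.
have [iD|iD] := leqP i d.*2; have [jD|jD] := leqP j d.*2.
- have : 2 ^ (d - uphalf j) <= 2 ^ (d - uphalf i).+1 by rewrite leq_exp2l //; lia.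
  rewrite expnS mulnBl mulnDl.
  have : 2 * 2 ^ (d - uphalf i) <= n * 2 ^ (d - uphalf i).
    by rewrite leq_mul2r n2 orbT.
  lia.
- have : 0 < 2 ^ (d - uphalf i) by rewrite expn_gt0.
  have : 2 * 2 ^ (d - uphalf i) <= n * 2 ^ (d - uphalf i).
    by rewrite leq_mul2r n2 orbT.
  rewrite mulnBl; lia.
- have -> : d - uphalf j = 0 by lia.
  lia.
- lia.
Qed.

Lemma potential_reachable (G : sgraph) d (e : nat -> G) (c c' : config G) :
  enumerates_path_square d.+1.*2 e -> reachable c c' ->
  \sum_(i < d.+1.*2.+1) height d i (c' (e i))
  <= \sum_(i < d.+1.*2.+1) height d i (c (e i)).
Proof.
move=> [e_inj e_surj e_adj]; elim=> {c c'} [c c'|c|c c1 c2 _ le1 _ le2] //;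
  last by exact: leq_trans le2 le1.
move=> [u [v [uv cu ->]]].
have [i iN uE] := e_surj u; have [j jN vE] := e_surj v; subst u v.
move: uv; rewrite e_adj // => /and3P[ij ij2 ji2].
have e_eq k l : k <= d.+1.*2 -> l <= d.+1.*2 -> (e k == e l) = (k == l).
  by move=> kN lN; apply/eqP/eqP => [/e_inj|->] //; apply.
have iN' : i < d.+1.*2.+1 by [].
have jN' : j < d.+1.*2.+1 by [].
have ji : Ordinal jN' != Ordinal iN' by rewrite eq_sym.
rewrite (bigD1 (Ordinal iN')) // (bigD1 (Ordinal jN')) //=.
rewrite [leqRHS](bigD1 (Ordinal iN')) //.
rewrite [X in _ <= _ + X](bigD1 (Ordinal jN')) //=.
rewrite !addnA leq_add //.
  rewrite !ffunE !e_eq // !eqxx eq_sym (negPf ij).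
  by apply: height_move.
apply: leq_sum => k /andP[ki kj].
have kN : k <= d.+1.*2 by rewrite -ltnS.
by rewrite ffunE !e_eq // ifN // ifN.
Qed.

Lemma pebbling_lower (G : sgraph) d (e : nat -> G) t m :
  enumerates_path_square d.+1.*2 e -> 0 < m -> pebbling_suffices G t m ->
  2 ^ d.+1 * t < m.
Proof.
move=> eP m0 suff; have [e_inj _ _] := eP.
(* The single pebble on [2 d + 1] has no potential, so the [m] pebbles together have only
   [(m - 1)./2], against [t * 2 ^ d] needed at 0. *)
pose far (i : nat) := if i == d.+1.*2 then m - 1 else (i == d.*2.+1 : nat).
have [c cE] : exists c : config G, forall i, i <= d.+1.*2 -> c (e i) = far i.
  exists [ffun x => \sum_(i < d.+1.*2.+1) (x == e i) * far i] => i iN.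
  rewrite ffunE (bigD1 (Ordinal (iN : i < d.+1.*2.+1))) //= eqxx mul1n.
  rewrite big1 ?addn0 // => j ji; case: eqP => // /e_inj ij.
  by case/eqP: ji; apply: val_inj => /=; rewrite ij // -ltnS.
have csum (F : nat -> nat -> nat) : (forall i, F i 0 = 0) ->
    \sum_(i < d.+1.*2.+1) F i (c (e i)) = F d.*2.+1 1 + F d.+1.*2 (m - 1).
  have far1 : far d.*2.+1 = 1 by rewrite /far; update_lia.
  have far2 : far d.+1.*2 = m - 1 by rewrite /far; update_lia.
  move=> F0; rewrite -(big_mkord xpredT (fun i => F i (c (e i)))).
  rewrite big_nat_recr //= [in X in X + _]doubleS big_nat_recr //= big_nat big1.
    by rewrite !cE ?far1 ?far2 //; lia.
  move=> i /andP[_ id]; rewrite cE; last by lia.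
  by have -> : far i = 0 by rewrite /far; update_lia.
have size_c : config_size c = m.
  by rewrite /config_size (sum_vertices _ eP) (csum (fun=> id)) //; lia.
have [c' [cc' tc']] := suff c (e 0) size_c.
have := potential_reachable eP cc'; rewrite (csum (height d)); last first.
  by move=> i; rewrite /height; case: ifP.
have -> : height d d.*2.+1 1 = 0 by rewrite /height ltnn.
have -> : height d d.+1.*2 (m - 1) = (m - 1)./2.
  by rewrite /height ifN // doubleS; lia.
rewrite big_ord_recl {1}/height /= subn0.
have : t * 2 ^ d <= c' (e 0) * 2 ^ d by rewrite leq_mul2r tc' orbT.
by rewrite expnS; lia.
Qed.

(** * The pebbling number and the pebbling property of path squares *)

Lemma path_square_pebbling_number (G : sgraph) d (e : nat -> G) t :
  enumerates_path_square d.+1.*2 e -> is_pebbling_number G t (2 ^ d.+1 * t + 1).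
Proof.
move=> eP; split; first by rewrite addn1.
- move=> c v cE; have [k kN ->] := let: And3 _ e_surj _ := eP in e_surj v.
  have [tk|kt] := leqP t (c (e k)); first by exists c; split=> //; apply: rt_refl.
  have := @reach_of_size G d.+1 e c k (t - c (e k)) eP kN.
  rewrite subnKC ?(ltnW kt) //; apply; rewrite cE mulnBr.
  have : c (e k) <= 2 ^ d.+1 * c (e k) by rewrite leq_pmull ?expn_gt0.
  have : 2 ^ d.+1 * c (e k) <= 2 ^ d.+1 * t by rewrite leq_mul2l (ltnW kt) orbT.
  by lia.
- by move=> m m0 suff; rewrite addn1; apply: pebbling_lower eP m0 suff.
Qed.

Lemma path_square_two_t_pebbling (G : sgraph) d (e : nat -> G) t :
  enumerates_path_square d.+1.*2 e -> 0 < t -> two_t_pebbling_property G t.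
Proof.
move=> eP t0; exists (2 ^ d.+1 * t + 1); split.
  exact: path_square_pebbling_number eP.
move=> c v big; have [k kN ->] := let: And3 _ e_surj _ := eP in e_surj v.
have [tk|kt] := leqP (2 * t) (c (e k)).
  by exists c; split=> //; apply: rt_refl.
have loadE : \sum_x load (c x) = config_size c + occupied c.
  rewrite /load big_split; congr (_ + _).
  rewrite /occupied -sum1dep_card [RHS]big_mkcond.
  by apply: eq_bigr => x _; case: ltnP.
rewrite -loadE in big.
have [s sE] : exists s, c (e k) + s = 2 * t by exists (2 * t - c (e k)); lia.
rewrite -sE; set z := c (e k) in kt sE *.
have X2 : 2 <= 2 ^ d.+1 by rewrite expnS leq_pmulr // expn_gt0.
have Xz : 2 * z <= 2 ^ d.+1 * z by rewrite leq_mul2r X2 orbT.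
have Xzs : 2 * (2 ^ d.+1 * t) = 2 ^ d.+1 * z + 2 ^ d.+1 * s.
  by rewrite mulnCA -sE mulnDr.
have [s1|s1] := ltnP 1 s.
  apply: (reach_of_load eP) => //; rewrite -/z.
  have : load z <= 2 * z by rewrite /load; lia.
  by lia.
(* [reach_of_load] needs two missing pebbles. With one missing, [z = 2 t - 1] is positive, and half
   the load is a sufficient lower bound for the size. *)
apply: (reach_of_size eP) => //; rewrite -/z.
have load2 : \sum_x load (c x) <= 2 * config_size c.
  rewrite /config_size big_distrr; apply: leq_sum => x _.
  by rewrite /load /=; lia.
have {}s1 : s = 1 by lia.
rewrite s1 muln1 in sE Xzs *.
have := leq_mul X2 (leqnn z.-1).
have : 2 ^ d.+1 * z = 2 ^ d.+1 * z.-1 + 2 ^ d.+1.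
  by rewrite -mulnSr prednK //; lia.
by lia.
Qed.

(** * The total graph of a path as the square of a path *)

(* The vertex [x_i] is sent to [2 i] and the edge between [x_i] and [x_(i+1)]
   to the sum [2 i + 1] of its endpoints; this is the ordering in which the
   total graph of a path is the square of a path. *)
Definition line_pos (n : nat) (x : total_graph (path_graph n)) : nat :=
  match x with
  | inl i => (i : 'I_n).*2
  | inr f => \sum_(i in val f) (i : 'I_n)
  end.

Lemma path_edgeP n (f : edge (path_graph n)) :
  exists a b : 'I_n, a.+1 = b /\ val f = [set a; b].
Proof.
have /imsetP[[a b] /=] := valP f; rewrite inE /path_adj /= => adjab ->.
case/orP: adjab => /eqP; first by exists a, b.
by exists b, a; rewrite setUC.
Qed.

Lemma line_pos_edge n (f : edge (path_graph n)) (a b : 'I_n) :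
  a.+1 = b -> val f = [set a; b] -> line_pos (inr f) = a.*2.+1.
Proof.
move=> ab fE; rewrite /line_pos fE big_setU1 ?big_set1 /=; first by lia.
by rewrite inE; apply/eqP => /(congr1 val) /=; lia.
Qed.

Lemma line_pos_inj n : injective (@line_pos n).
Proof.
move=> [i|f] [j|g].
- by move=> /double_inj ij; congr inl; apply: val_inj.
- have [a [b [ab gE]]] := path_edgeP g; rewrite (line_pos_edge ab gE) /=; lia.
- have [a [b [ab fE]]] := path_edgeP f; rewrite (line_pos_edge ab fE) /=; lia.
have [a [b [ab fE]]] := path_edgeP f; have [a' [b' [ab' gE]]] := path_edgeP g.
rewrite (line_pos_edge ab fE) (line_pos_edge ab' gE) => -[/double_inj aa'].
congr inr; apply: val_inj; rewrite fE gE.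
by congr [set _; _]; apply: val_inj => //=; rewrite -ab -ab' aa'.
Qed.

Lemma line_pos_adj n (x y : total_graph (path_graph n)) :
  adj x y = [&& line_pos x != line_pos y, line_pos x <= (line_pos y).+2
              & line_pos y <= (line_pos x).+2].
Proof.
case: x y => [i|f] [j|g].
- by rewrite /= /path_adj; lia.
- have [a [b [ab gE]]] := path_edgeP g; rewrite (line_pos_edge ab gE) /= gE.
  by rewrite !inE -!val_eqE /=; lia.
- have [a [b [ab fE]]] := path_edgeP f; rewrite (line_pos_edge ab fE) /= fE.
  by rewrite !inE -!val_eqE /=; lia.
have -> : adj (inr f : total_graph _) (inr g)
          = (line_pos (inr f) != line_pos (inr g)) && (val f :&: val g != set0).
  by rewrite (inj_eq (@line_pos_inj n)).
have [a [b [ab fE]]] := path_edgeP f; have [a' [b' [ab' gE]]] := path_edgeP g.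
rewrite (line_pos_edge ab fE) (line_pos_edge ab' gE) fE gE.
have -> : ([set a; b] :&: [set a'; b'] != set0)
          = [|| a \in [set a'; b'] | b \in [set a'; b']].
  apply/set0Pn/orP => [[x]|].
    by rewrite !in_setI in_set2 => /andP[/orP[]/eqP-> xg]; [left | right].
  by case=> h; [exists a | exists b]; rewrite in_setI h in_set2 eqxx ?orbT.
by rewrite !inE -!val_eqE /=; lia.
Qed.

Lemma total_path_square d : exists e : nat -> total_graph (path_graph d.+1),
  enumerates_path_square d.*2 e.
Proof.
have surj i : i <= d.*2 ->
    exists x : total_graph (path_graph d.+1), line_pos x = i.
  move=> id; have ih : i./2 < d.+1 by lia.
  have [io|ie] := boolP (odd i); last by exists (inl (Ordinal ih)) => /=; lia.
  have ih1 : i./2.+1 < d.+1 by lia.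
  have fP : [set Ordinal ih; Ordinal ih1] \in edges (path_graph d.+1).
    apply/imsetP; exists (Ordinal ih, Ordinal ih1) => //.
    by rewrite inE; apply/orP; left => /=.
  pose f : edge (path_graph d.+1) := Sub [set Ordinal ih; Ordinal ih1] fP.
  exists (inr f); rewrite (@line_pos_edge _ f (Ordinal ih) (Ordinal ih1)) //=.
  by lia.
have posN (x : total_graph (path_graph d.+1)) : line_pos x <= d.*2.
  case: x => [i|f]; first by have := ltn_ord i; rewrite /=; lia.
  have [a [b [ab fE]]] := path_edgeP f; rewrite (line_pos_edge ab fE).
  by have := ltn_ord b; lia.
pose x0 : total_graph (path_graph d.+1) := inl ord0.
(* [e] inverts [line_pos]; the default [x0] is returned only for [i] beyond [d.*2]. *)
pose e i := odflt x0 [pick x | line_pos x == i].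
have eK i : i <= d.*2 -> line_pos (e i) = i.
  move=> /surj[x xi]; rewrite /e; case: pickP => [y /eqP //|/(_ x)].
  by rewrite xi eqxx.
exists e; split.
- by move=> i j iN jN /(congr1 (@line_pos _)); rewrite !eK.
- move=> x; exists (line_pos x); rewrite ?posN //.
  by apply: line_pos_inj; rewrite eK.
- by move=> i j iN jN; rewrite line_pos_adj !eK.
Qed.

Theorem theorem7p1 (n : nat) (hn : 2 <= n) (t : nat) (ht : 0 < t) :
  two_t_pebbling_property (total_graph (path_graph n)) t.
Proof.
case: n hn => [|[|d]] // _; have [e eP] := total_path_square d.+1.
exact: path_square_two_t_pebbling eP ht.
Qed.
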